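(* Let $R$ be an arbitrary (not necessarily unital) ring with stable rank one and let $P \in \mathcal{CP}(R)$. Then the ring $K(P)$ has stable rank one.
   Context: Rings are associative, not necessarily unital unless stated. For an arbitrary ring $R$, $R^+ = \mathbb{Z}\oplus R$ denotes the Dorroh unitization, in which $R$ is a two-sided ideal. An arbitrary ring $R$ has stable rank one if for all $a,b,x\in R^+$ with $a-1\in R$ and $xa+b=1$ there is $y\in R^+$ (equivalently $y\in R$) such that $a+yb$ is invertible in $R^+$. For unital $R$ this is equivalent to: for all $a,b\in R$ with $Ra+Rb=R$ there is $y\in R$ with $R(a+yb)=R$. If $R$ is a right ideal of a ring $R'$ with unit $1'$, the condition is equivalent to: for all $a,b,x\in R'$ with $a-1'\in R$ and $xa+b=1'$ there is $y\in R'$ (equivalently $y\in R$) such that $a+yb$ is a unit of $R'$. $\mathcal{CP}(R)$ denotes the class of all countably generated unital projective right $R^+$-modules $P$ with $P=PR$. (For unital $R$ these are just the countably generated projective unital right $R$-modules.) For a right module $P$ over a unital ring $S$ (here $S=R^+$), $K(P)$ is the two-sided ideal of $\mathrm{End}_S(P)$ consisting of finite sums of maps $\theta_{q,\sigma}\colon p\mapsto q\,\sigma(p)$ with $q\in P$, $\sigma\in\mathrm{Hom}_S(P,S)$; equivalently, the endomorphisms of $P$ that factor through $S^m$ for some $m\in\mathbb{N}$. It is viewed as a (possibly non-unital) ring. *)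

(* Defs.v *)
From HB Require Import structures.
From mathcomp Require Import all_boot all_order all_algebra.
From mathcomp Require Import boolp.

Set Implicit Arguments.
Unset Strict Implicit.
Unset Printing Implicit Defensive.

Import GRing.Theory.
Local Open Scope ring_scope.

(* The ring structures of MathComp are all unital; an rngType is an
   associative ring that need not have a unit. *)
HB.mixin Record Zmodule_isRng R of GRing.Zmodule R := {
  rngmul : R -> R -> R;
  rngmulA : associative rngmul;
  rngmulDl : left_distributive rngmul +%R;
  rngmulDr : right_distributive rngmul +%R;
}.

#[short(type="rngType")]
HB.structure Definition Rng := { R of GRing.Zmodule R & Zmodule_isRng R }.

Section RngTheory.
Variable R : rngType.
Implicit Types x y : R.

Lemma rngmul0l y : rngmul 0 y = 0.
Proof. by apply: (addrI (rngmul 0 y)); rewrite -rngmulDl !addr0. Qed.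

Lemma rngmul0r x : rngmul x 0 = 0.
Proof. by apply: (addrI (rngmul x 0)); rewrite -rngmulDr !addr0. Qed.

Lemma rngmulNl x y : rngmul (- x) y = - rngmul x y.
Proof. by apply: (addrI (rngmul x y)); rewrite -rngmulDl !subrr rngmul0l. Qed.

Lemma rngmulNr x y : rngmul x (- y) = - rngmul x y.
Proof. by apply: (addrI (rngmul x y)); rewrite -rngmulDr !subrr rngmul0r. Qed.

Lemma rngmulMnl x y n : rngmul (x *+ n) y = rngmul x y *+ n.
Proof.
by elim: n => [|n IHn]; rewrite ?mulr0n ?rngmul0l // !mulrS rngmulDl IHn.
Qed.

Lemma rngmulMnr x y n : rngmul x (y *+ n) = rngmul x y *+ n.
Proof.
by elim: n => [|n IHn]; rewrite ?mulr0n ?rngmul0r // !mulrS rngmulDr IHn.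
Qed.

Lemma rngmulMzl x y (m : int) : rngmul (x *~ m) y = rngmul x y *~ m.
Proof.
case: m => n; first by rewrite -!pmulrn rngmulMnl.
by rewrite NegzE !mulrNz rngmulNl -!pmulrn rngmulMnl.
Qed.

Lemma rngmulMzr x y (m : int) : rngmul x (y *~ m) = rngmul x y *~ m.
Proof.
case: m => n; first by rewrite -!pmulrn rngmulMnr.
by rewrite NegzE !mulrNz rngmulNr -!pmulrn rngmulMnr.
Qed.

End RngTheory.

(* The Dorroh unitization R^+ = Z (+) R. *)
Definition dorroh (R : rngType) : Type := (int * R)%type.

Section Dorroh.
Variable R : rngType.

HB.instance Definition _ := GRing.Zmodule.copy (dorroh R) (int * R)%type.

Definition dorroh_one : dorroh R := (1, 0).

Definition dorroh_mul (a b : dorroh R) : dorroh R :=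
  (a.1 * b.1, b.2 *~ a.1 + a.2 *~ b.1 + rngmul a.2 b.2).

Lemma dorroh_mulA : associative dorroh_mul.
Proof.
move=> [m x] [n y] [p z]; rewrite /dorroh_mul /=; congr pair.
  by rewrite mulrA.
rewrite !mulrzDl !rngmulDl !rngmulDr !rngmulMzl !rngmulMzr rngmulA -!mulrzA.
rewrite [m * n]mulrC [m * p]mulrC -!addrA; do 2 congr (_ + _).
rewrite addrCA; congr (_ + _).
by rewrite [RHS]addrCA; congr (_ + _); rewrite addrCA.
Qed.

Lemma dorroh_mul1l : left_id dorroh_one dorroh_mul.
Proof.
by move=> [m x]; rewrite /dorroh_mul /= mul1r mulr1z mul0rz rngmul0l !addr0.
Qed.

Lemma dorroh_mul1r : right_id dorroh_one dorroh_mul.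
Proof.
by move=> [m x]; rewrite /dorroh_mul /= mulr1 mulr1z mul0rz rngmul0r add0r addr0.
Qed.

Lemma dorroh_mulDl : left_distributive dorroh_mul +%R.
Proof.
move=> [m x] [n y] [p z]; rewrite /dorroh_mul /=.
congr pair => /=; first by rewrite mulrDl.
by rewrite mulrzDr mulrzDl rngmulDl [RHS]addrACA; congr (_ + _); rewrite addrACA.
Qed.

Lemma dorroh_mulDr : right_distributive dorroh_mul +%R.
Proof.
move=> [m x] [n y] [p z]; rewrite /dorroh_mul /=.
congr pair => /=; first by rewrite mulrDr.
by rewrite mulrzDr mulrzDl rngmulDr [RHS]addrACA; congr (_ + _); rewrite addrACA.
Qed.

Lemma dorroh_one_neq0 : dorroh_one != 0.
Proof. by []. Qed.

HB.instance Definition _ := GRing.Zmodule_isNzRing.Build (dorroh R)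
  dorroh_mulA dorroh_mul1l dorroh_mul1r dorroh_mulDl dorroh_mulDr
  dorroh_one_neq0.

Definition dorroh_in (r : R) : dorroh R := (0, r).

End Dorroh.

Definition invertible (S : pzRingType) (c : S) : Prop :=
  exists u : S, u * c = 1 /\ c * u = 1.

Definition stable_rank_one (R : rngType) : Prop :=
  forall a b x : dorroh R,
    (exists r : R, a - 1 = dorroh_in r) -> x * a + b = 1 ->
    exists y : dorroh R, invertible (a + y * b).

(* A right S-module is a left module over the converse ring S^c; the product
   p . s of p : P by s : S is (s : S^c) *: p. *)
Notation rmodType S := (lmodType (S : pzRingType)^c).

Section RightModules.
Variables (S : pzRingType) (P : rmodType S).

Definition projective : Prop :=
  forall (M N : rmodType S) (f : {linear M -> N}) (g : {linear P -> N}),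
    (forall y : N, exists x : M, f x = y) ->
    exists h : {linear P -> M}, forall p : P, f (h p) = g p.

Definition countably_generated : Prop :=
  exists e : nat -> P, forall p : P,
    exists (n : nat) (s : nat -> S), p = \sum_(i < n) (s i : S^c) *: e i.

Definition rend : Type := {linear P -> P}.

HB.instance Definition _ := gen_eqMixin rend.
HB.instance Definition _ := gen_choiceMixin rend.

Lemma rendP (f g : rend) : (forall p : P, f p = g p) -> f = g.
Proof.
move=> fg; case: f g fg => [f cf] [g cg] /= /funext fg; case: g / fg cg => cg.
congr GRing.Linear.Pack; case: cf cg => [[f1] [f2]] [[g1] [g2]].
by congr GRing.Linear.Class; [congr GRing.isNmodMorphism.Axioms_
  | congr GRing.isScalable.Axioms_]; exact: Prop_irrelevance.
Qed.

Definition rend_zero : rend := \0.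
Definition rend_opp (f : rend) : rend := \- f.
Definition rend_add (f g : rend) : rend := f \+ g.
Definition rend_one : rend := idfun.
Definition rend_mul (f g : rend) : rend := f \o g.

Lemma rend_addA : associative rend_add.
Proof. by move=> f g h; apply: rendP => p; rewrite /= addrA. Qed.

Lemma rend_addC : commutative rend_add.
Proof. by move=> f g; apply: rendP => p; rewrite /= addrC. Qed.

Lemma rend_add0 : left_id rend_zero rend_add.
Proof. by move=> f; apply: rendP => p; rewrite /= add0r. Qed.

Lemma rend_addN : left_inverse rend_zero rend_opp rend_add.
Proof. by move=> f; apply: rendP => p; rewrite /= addNr. Qed.

HB.instance Definition _ := GRing.isZmodule.Build rend
  rend_addA rend_addC rend_add0 rend_addN.

Lemma rend_mulA : associative rend_mul.
Proof. by move=> f g h; apply: rendP. Qed.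

Lemma rend_mul1l : left_id rend_one rend_mul.
Proof. by move=> f; apply: rendP. Qed.

Lemma rend_mul1r : right_id rend_one rend_mul.
Proof. by move=> f; apply: rendP. Qed.

Lemma rend_mulDl : left_distributive rend_mul +%R.
Proof. by move=> f g h; apply: rendP. Qed.

Lemma rend_mulDr : right_distributive rend_mul +%R.
Proof. by move=> f g h; apply: rendP => p; rewrite /= raddfD. Qed.

HB.instance Definition _ := GRing.Zmodule_isPzRing.Build rend
  rend_mulA rend_mul1l rend_mul1r rend_mulDl rend_mulDr.

(* Hom_S(P, S), where S is a right module over itself. *)
Definition rdual : Type := {linear P -> (S^c)^o}.

Definition theta_fun (q : P) (sigma : rdual) (p : P) : P := (sigma p : S^c) *: q.

Lemma theta_fun_linear (q : P) (sigma : rdual) : linear (theta_fun q sigma).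
Proof.
move=> c p p'; rewrite /theta_fun linearP scalerDl; congr (_ + _).
exact/esym/(scalerA c (sigma p : S^c)).
Qed.

HB.instance Definition _ (q : P) (sigma : rdual) :=
  GRing.isLinear.Build (S^c) P P *:%R (theta_fun q sigma)
    (theta_fun_linear q sigma).

Definition theta (q : P) (sigma : rdual) : rend := theta_fun q sigma.

Definition sum_of_thetas (f : rend) : Prop :=
  exists (n : nat) (q : 'I_n -> P) (sigma : 'I_n -> rdual),
    f = \sum_(i < n) theta (q i) (sigma i).

Definition compactop : {pred rend} := fun f => `[< sum_of_thetas f >].

Lemma theta_mull (f : rend) q sigma : f * theta q sigma = theta (f q) sigma.
Proof. by apply: rendP => p; rewrite /= /theta_fun linearZ. Qed.

Lemma theta_mulr (f : rend) q (sigma : rdual) :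
  theta q sigma * f = theta q (sigma \o f : {linear P -> (S^c)^o}).
Proof. exact: rendP. Qed.

Lemma compactop_ideal_l (f g : rend) : g \in compactop -> f * g \in compactop.
Proof.
move=> /asboolP[n [q [sigma ->]]]; apply/asboolP.
exists n, (fun i => f (q i)), sigma.
by rewrite mulr_sumr; apply: eq_bigr => i _; exact: theta_mull.
Qed.

Lemma compactop_ideal_r (f g : rend) : f \in compactop -> f * g \in compactop.
Proof.
move=> /asboolP[n [q [sigma ->]]]; apply/asboolP.
exists n, q, (fun i => sigma i \o g : {linear P -> (S^c)^o}).
by rewrite mulr_suml; apply: eq_bigr => i _; exact: theta_mulr.
Qed.

Lemma compactop_zmod_closed : zmod_closed compactop.
Proof.
split.
  apply/asboolP; exists 0, (fun=> 0), (fun=> \0 : {linear P -> (S^c)^o}).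
  by rewrite big_ord0.
move=> f g fK /(compactop_ideal_l (- 1)); rewrite mulN1r.
move: fK => /asboolP[m [q [sigma ->]]] /asboolP[n [q' [sigma' ->]]].
apply/asboolP; exists (m + n)%N.
exists (fun i => match split i with inl j => q j | inr k => q' k end).
exists (fun i => match split i with inl j => sigma j | inr k => sigma' k end).
rewrite big_split_ord; congr (_ + _); apply: eq_bigr => i _.
  by rewrite (unsplitK (inl i)).
by rewrite (unsplitK (inr i)).
Qed.

HB.instance Definition _ := GRing.isZmodClosed.Build rend compactop
  compactop_zmod_closed.

(* The ideal K(P) of End_S(P), as a ring in its own right. *)
Record Kring : Type := MkKring { Kval : rend; _ : Kval \in compactop }.

HB.instance Definition _ := [isSub for Kval].
HB.instance Definition _ := [Choice of Kring by <:].
HB.instance Definition _ := [SubChoice_isSubZmodule of Kring by <:].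

Definition Kmul (f g : Kring) : Kring :=
  MkKring (compactop_ideal_l (val f) (valP g)).

Lemma KmulA : associative Kmul.
Proof. by move=> f g h; apply: val_inj; rewrite /= mulrA. Qed.

Lemma KmulDl : left_distributive Kmul +%R.
Proof. by move=> f g h; apply: val_inj; rewrite /= mulrDl. Qed.

Lemma KmulDr : right_distributive Kmul +%R.
Proof. by move=> f g h; apply: val_inj; rewrite /= mulrDr. Qed.

HB.instance Definition _ := Zmodule_isRng.Build Kring KmulA KmulDl KmulDr.

End RightModules.

(* P = PR, where PR is the additive subgroup generated by the products p . r
   with p in P and r in R. *)
Definition generated_by_products (R : rngType) (P : rmodType (dorroh R)) : Prop :=
  forall p : P, exists (n : nat) (q : 'I_n -> P) (r : 'I_n -> R),
    p = \sum_(i < n) (dorroh_in (r i) : (dorroh R)^c) *: q i.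

Definition CP (R : rngType) (P : rmodType (dorroh R)) : Prop :=
  [/\ countably_generated P, projective P & generated_by_products P].

(* Main.v *)
Require Import Defs.
From HB Require Import structures.
From mathcomp Require Import all_boot all_order all_algebra.
From mathcomp Require Import boolp.

(** The elements of [K(P)] are the endomorphisms of finite rank, and an element
    of the unitization congruent to 1 acts on [P] as [a = 1 - f], where [f] is a
    sum of [n] operators [theta q sigma].  The whole argument takes place in
    [End(P)] and proceeds by induction on [n].

    Rank one.  By Jacobson's lemma, [1 - theta q tau] is invertible in [End(P)]
    as soon as the scalar [1 - tau q] is invertible in [S = R^+]
    ([invertible_one_sub_theta]).  From [x (1 - theta q sigma) + b = 1],
    evaluating at [q] and applying [sigma] gives in [S] the relation
    [(1 + sigma (x q)) (1 - sigma q) + sigma (b q) = 1].  Since [P = PR], the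
    scalar [sigma q] lies in [R], so stable rank one of [R] provides [s] with
    [1 - sigma q + s sigma (b q)] invertible.  That scalar is [1 - tau q] for
    [tau = sigma - s (sigma o b)], and [1 - theta q tau] is
    [1 - theta q sigma + theta (q s) sigma * b], a correction of the required
    form ([rank_one_stable]).  Multiplying by a unit [u] extends this to
    [u - theta q sigma] ([unit_sub_theta_stable]).

    Induction step.  If [x (1 - f - t) + b = 1] with [t] of rank one, then
    [x (1 - f) + (b - x t) = 1], and the induction hypothesis yields [y] such
    that [u = 1 - f + y (b - x t)] is invertible.  Then
    [1 - f - t + y b = u - (1 - y x) t] is a rank-one perturbation of a unit,
    and the case already treated applies to it ([finite_rank_stable]).

    Invertibility transfers from [End(P)] back to the unitization of [K(P)]
    because the inverse of [1 + k] is [1 - w k], again congruent to 1 modulo the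
    ideal [K(P)] ([invertible_act]). *)

Set Implicit Arguments.
Unset Strict Implicit.
Unset Printing Implicit Defensive.

Import GRing.Theory.
Local Open Scope ring_scope.

Lemma invertibleM (S : pzRingType) (c d : S) :
  invertible c -> invertible d -> invertible (c * d).
Proof.
move=> [u [uc cu]] [v [vd dv]]; exists (v * u); split.
  by rewrite mulrA -(mulrA v) uc mulr1.
by rewrite mulrA -(mulrA c) dv mulr1.
Qed.

(** * Operators of rank one *)

Section RankOne.
Variables (S : pzRingType) (P : rmodType S).
Implicit Types (q : P) (sigma tau : rdual P).

Lemma thetaBl q q' sigma : theta (q - q') sigma = theta q sigma - theta q' sigma.
Proof. by apply: rendP => p; rewrite /= /theta_fun scalerBr. Qed.

Lemma theta_comp q sigma q' tau :
  theta q sigma * theta q' tau = theta ((sigma q' : S^c) *: q) tau.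
Proof. by rewrite theta_mull. Qed.

Lemma theta_compact q sigma : theta q sigma \in @compactop _ P.
Proof.
apply/asboolP; exists 1, (fun=> q), (fun=> sigma).
by rewrite big_ord1.
Qed.

(** Jacobson's lemma: [theta q tau] is the composite of [tau : P -> S] and
    [s |-> q s : S -> P], and [1 - u v] is inverted by [1 + u w v] when [w]
    inverts [1 - v u]. *)
Lemma invertible_one_sub_theta q tau :
  invertible (1 - tau q : S) -> invertible (1 - theta q tau).
Proof.
move=> [w [wv vw]].
have wtau : w * (tau q : S) = w - 1.
  by rewrite -[X in w - X]wv mulrBr mulr1 subKr.
have tauw : (tau q : S) * w = w - 1.
  by rewrite -[X in w - X]vw mulrBl mul1r subKr.
set g := theta q tau; pose h := theta ((w : S^c) *: q) tau.
have hg : h * g = h - g.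
  rewrite theta_comp scalerA -[(_ * _ : S^c)]/(w * (tau q : S)) wtau.
  by rewrite scalerBl scale1r thetaBl.
have gh : g * h = h - g.
  rewrite theta_comp.
  have -> : tau ((w : S^c) *: q) = (w - 1 : S) by rewrite linearZ -tauw.
  by rewrite scalerBl scale1r thetaBl.
exists (1 + h); split.
  by rewrite mulrDl mul1r mulrBr mulr1 hg subKr subrK.
by rewrite mulrDr mulr1 mulrBl mul1r gh subKr subrK.
Qed.

Definition lscale_dual (s : S) sigma (p : P) : (S^c)^o := s * (sigma p : S).

Lemma lscale_dual_linear s sigma : linear (lscale_dual s sigma).
Proof.
move=> c p p'; rewrite /lscale_dual linearP mulrDr; congr (_ + _).
exact: (mulrA s (sigma p : S) (c : S)).
Qed.

HB.instance Definition _ s sigma :=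
  GRing.isLinear.Build (S^c) P (S^c)^o *:%R (lscale_dual s sigma)
    (lscale_dual_linear s sigma).

(** The correction [theta (q s) sigma * b] amounts to replacing [sigma] by
    [sigma - s (sigma o b)], so the operator keeps the form covered by Jacobson's
    lemma. *)
Lemma one_sub_theta_correct q sigma (b : rend P) (s : S) :
  invertible (1 - (sigma q : S) + s * sigma (b q)) ->
  invertible (1 - theta q sigma + theta ((s : S^c) *: q) sigma * b).
Proof.
pose tau : rdual P :=
  sigma \- ((lscale_dual s sigma : rdual P) \o b : {linear P -> (S^c)^o}).
have -> : 1 - (sigma q : S) + s * sigma (b q) = 1 - tau q.
  by rewrite /= opprD opprK addrA.
move=> /invertible_one_sub_theta; congr invertible.
rewrite -addrA theta_mulr; congr (1 + _); apply: rendP => p /=.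
by rewrite /theta_fun scalerBl opprB addrC scalerA.
Qed.

End RankOne.

(** * Perturbations of finite rank *)

Section StableRank.
Variables (R : rngType) (P : rmodType (dorroh R)).
Hypotheses (R1 : stable_rank_one R) (PR : generated_by_products P).
Implicit Types (q : P) (sigma : rdual P) (x b : rend P).

(** This is where [P = PR] enters: [sigma (PR) = sigma (P) R], and [R] is an
    ideal of its unitization. *)
Lemma dual_in_ring sigma q : exists r : R, (sigma q : dorroh R) = dorroh_in r.
Proof.
suff H : (sigma q : dorroh R).1 = 0.
  by exists (sigma q : dorroh R).2; rewrite [LHS]surjective_pairing H.
have [n [p [r ->]]] := PR q; rewrite linear_sum.
apply: (big_ind (fun c : dorroh R => c.1 = 0)) => // [c d c0 d0|i _].
  by rewrite [LHS]/= c0 d0.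
by rewrite linearZ; exact: mulr0.
Qed.

Lemma rank_one_stable q sigma x b : x * (1 - theta q sigma) + b = 1 ->
  exists2 y, y \in @compactop _ P & invertible (1 - theta q sigma + y * b).
Proof.
move=> xab.
pose c : dorroh R := sigma q; pose d : dorroh R := sigma (b q).
pose e : dorroh R := sigma (x q).
have /(R1 (x := 1 + e)) R1' : exists r : R, 1 - c - 1 = dorroh_in r.
  have [r cE] := dual_in_ring sigma q; exists (- r).
  by rewrite addrAC subrr add0r /c cE; congr pair; rewrite oppr0.
(* Apply [sigma] to the value of [xab] at [q]. *)
have ed : (1 + e) * (1 - c) + d = 1.
  have : e * (1 - c) + d = c.
    rewrite -[RHS]/(sigma ((1 : rend P) q) : dorroh R) -xab.
    rewrite /= raddfD /= !linearB /= /theta_fun !linearZ /=.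
    by rewrite mulrBr mulr1 -[_ *: _]/(- e * c) mulNr.
  by rewrite mulrDl mul1r -addrA => ->; rewrite subrK.
have [s /one_sub_theta_correct inv] := R1' _ ed.
by exists (theta ((s : (dorroh R)^c) *: q) sigma) => //; exact: theta_compact.
Qed.

(** Factoring out [u] turns the perturbation into [1 - theta (u^-1 q) sigma], and
    [x u] takes the place of [x]. *)
Lemma unit_sub_theta_stable (u : rend P) q sigma x b : invertible u ->
  x * (u - theta q sigma) + b = 1 ->
  exists2 y, y \in @compactop _ P & invertible (u - theta q sigma + y * b).
Proof.
move=> u_inv; have [w [wu uw]] := u_inv.
have -> : u - theta q sigma = u * (1 - theta (w q) sigma).
  by rewrite mulrBr mulr1 -theta_mull mulrA uw mul1r.
rewrite mulrA => /rank_one_stable[y yK inv].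
exists (u * y); first exact: compactop_ideal_l.
by rewrite -mulrA -mulrDr; exact: invertibleM.
Qed.

(** Induction on the number of terms: the last term [t] is first moved into [b],
    and the unit obtained for the others is then perturbed by the rank-one
    operator [(1 - y x) t]. *)
Lemma finite_rank_stable n (q : 'I_n -> P) (sigma : 'I_n -> rdual P) x b :
  x * (1 - \sum_(i < n) theta (q i) (sigma i)) + b = 1 ->
  exists2 y, y \in @compactop _ P &
    invertible (1 - \sum_(i < n) theta (q i) (sigma i) + y * b).
Proof.
elim: n => [|n IHn] in q sigma x b *.
  move=> _; exists 0; first exact: rpred0.
  by rewrite big_ord0 subr0 mul0r addr0; exists 1; rewrite mulr1.
rewrite big_ord_recr /=; set f := \sum_(i < n) _.
set t := theta _ _; set a := 1 - (f + t) => xab.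
have [y yK inv] : exists2 y, y \in @compactop _ P &
    invertible (1 - f + y * (b - x * t)).
  apply: (IHn _ _ x); rewrite -[RHS]xab addrCA -mulrBr addrC /a opprD.
  by rewrite addrA.
set u := 1 - f + _ in inv.
have aybE : a + y * b = u - theta ((1 - y * x) (q ord_max)) (sigma ord_max).
  rewrite -theta_mull -/t mulrBl mul1r /u mulrBr mulrA /a.
  by rewrite opprB opprD -!addrA addKr [- t + _]addrC.
(* From [x a + b = 1] follows [x (a + y b) + (1 - x y) b = 1], so the rank-one
   case applies to [a + y b], and its corrections remain multiples of [b]. *)
have [|z zK] := @unit_sub_theta_stable u ((1 - y * x) (q ord_max))
  (sigma ord_max) x ((1 - x * y) * b) inv.
  rewrite -aybE mulrBl mul1r mulrDr !mulrA -addrA.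
  by rewrite [_ + (b - _)]addrC subrK.
rewrite -aybE mulrA -addrA -mulrDl => inv'.
exists (y + z * (1 - x * y)) => //.
by rewrite rpredD // compactop_ideal_r.
Qed.

End StableRank.

(** * The unitization of K(P) acting on P *)

Section Unitization.
Variables (S : pzRingType) (P : rmodType S).

(** The ring morphism from the unitization of [K(P)] to [End(P)].  It is not
    injective in general (it is not when the identity of [P] has finite rank),
    hence the condition on integer parts in [act_inj]. *)
Definition act (c : dorroh (Kring P)) : rend P := c.1%:~R + val c.2.

Lemma act1 : act 1 = 1.
Proof. by rewrite /act addr0. Qed.

Lemma actD c d : act (c + d) = act c + act d.
Proof. by rewrite /act intrD addrACA. Qed.

Lemma actM c d : act (c * d) = act c * act d.
Proof.
case: c d => [m f] [n g]; rewrite /act mulrDl !mulrDr -intrM -!addrA.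
congr (_ + _); rewrite mulrzl mulrzr.
have -> : (((m, f) : dorroh _) * (n, g)).2 = g *~ m + f *~ n + Kmul f g by [].
by rewrite !raddfD -!raddfMz /= addrA.
Qed.

Lemma act_in (k : Kring P) : act (dorroh_in k) = val k.
Proof. by rewrite /act add0r. Qed.

Lemma act_inj (c d : dorroh (Kring P)) : c.1 = d.1 -> act c = act d -> c = d.
Proof.
by case: c d => [m f] [n g] /= ->; rewrite /act /= => /addrI/val_inj->.
Qed.

(** If [w (1 + k) = 1] then [w = 1 - w k], and [w k] stays in the ideal, so the
    inverse in [End(P)] comes from the unitization with integer part 1. *)
Lemma invertible_act (k : Kring P) :
  invertible (1 + val k) -> invertible (1 + dorroh_in k).
Proof.
move=> [w [wk kw]].
have lK : - (w * val k) \in @compactop _ P.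
  by rewrite rpredN compactop_ideal_l // (valP k).
pose l : Kring P := MkKring lK.
have lE : 1 + val l = w by rewrite /= -[X in X - _]wk mulrDr mulr1 addrK.
exists (1 + dorroh_in l); split; apply: act_inj => //.
  by rewrite actM !actD act1 !act_in lE.
by rewrite actM !actD act1 !act_in lE.
Qed.

End Unitization.

Theorem proposition3p11 (R : rngType) (P : rmodType (dorroh R)) :
  stable_rank_one R -> CP P -> stable_rank_one (Kring P).
Proof.
move=> R1 [_ _ PR] a b x [k /(canRL (subrK _)) aE] xab.
have : val (- k) \in @compactop _ P := valP (- k).
move=> /asboolP[n [q [sigma kE]]].
have actaE : act a = 1 - \sum_(i < n) theta (q i) (sigma i).
  by rewrite -kE aE actD act_in act1 raddfN opprK addrC.
have := congr1 (@act _ _) xab; rewrite actD actM act1 actaE.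
move=> /(finite_rank_stable R1 PR)[y yK]; rewrite -actaE => inv.
exists (dorroh_in (MkKring yK)).
set c := a + _ * b.
have cE : c = 1 + dorroh_in c.2.
  by rewrite [LHS]surjective_pairing; congr pair;
     rewrite /c aE /= ?add0r ?mul0r ?addr0.
rewrite cE; apply: invertible_act; rewrite -act_in -act1 -actD -cE.
by rewrite actD actM act_in.
Qed.
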